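(* Let $\mathbf{A} \in \mathbb{C}^{p\times p}$ be a nonzero positive semidefinite matrix, and for $\alpha > 0$ and $\lambda > \lambda_0 = \lambda_0(\alpha)$ let $\mu$ be the unique solution in $(\mu_0, \infty)$, $\mu_0 = \mu_0(\alpha)$, to $$\lambda = \mu \left(1 - \tfrac{1}{\alpha}\tfrac{1}{p} \operatorname{tr}\left[\mathbf{A} (\mathbf{A} + \mu \mathbf{I}_p)^{-1}\right]\right).$$ For a fixed $\alpha > 0$, the map $\lambda \mapsto \mu(\lambda)$ is monotonically increasing in $\lambda$ over $(\lambda_0, \infty)$, and $\lim_{\lambda \searrow \lambda_0} \mu(\lambda) = \mu_0$, while $\lim_{\lambda \nearrow \infty} \mu(\lambda) = \infty$. For a fixed $\lambda \ge 0$, the map $\alpha \mapsto \mu(\alpha)$ is monotonically decreasing in $\alpha$ over $(0, \infty)$; when $\lambda < 0$, the map $\alpha \mapsto \mu(\alpha)$ is monotonically decreasing over $(0, r(\mathbf{A}))$ and monotonically increasing over $(r(\mathbf{A}), \infty)$. Furthermore, for any $\lambda \in (\lambda_0, \infty)$, $\lim_{\alpha \searrow 0} \mu(\alpha) = \infty$, and $\lim_{\alpha \nearrow \infty} \mu(\alpha) = \lambda$.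
   Context: $r(\mathbf{A}) = \tfrac{1}{p}\operatorname{rank}(\mathbf{A})$; $\lambda_{\min}^{+}(\mathbf{A})$ is the smallest positive eigenvalue of $\mathbf{A}$; $\alpha = q/p$ is the sketching aspect ratio, treated as a positive real parameter. The quantities $\mu_0, \lambda_0 \in \mathbb{R}$ (depending on $\alpha$ and $\mathbf{A}$) are the unique solutions, satisfying $\mu_0 > -\lambda_{\min}^{+}(\mathbf{A})$, to $$\alpha = \tfrac{1}{p} \operatorname{tr}\left[\mathbf{A}^2 (\mathbf{A} + \mu_0 \mathbf{I}_p)^{-2}\right], \qquad \lambda_0 = \mu_0 \left(1 - \tfrac{1}{\alpha}\tfrac{1}{p} \operatorname{tr}\left[\mathbf{A} (\mathbf{A} + \mu_0 \mathbf{I}_p)^{-1}\right]\right).$$ When $\mathbf{A}$ is singular, $\mathbf{A}(\mathbf{A}+x\mathbf{I}_p)^{-1}$ and its square at $x = 0$ are understood by continuous extension (i.e. zero eigenvalues of $\mathbf{A}$ contribute $0$). Monotonicity is meant in the non-strict sense. For fixed $\lambda$, $\mu(\alpha)$ is defined only for those $\alpha$ with $\lambda > \lambda_0(\alpha)$; the monotonicity statements in $\alpha$ are over the portion of the stated interval where this holds, and each limit in $\alpha$ is for those $\lambda$ satisfying $\lambda > \lambda_0(\alpha)$ along the limit. *)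

(* Defs.v *)
From mathcomp Require Import all_boot all_order all_algebra.
From mathcomp Require Import complex.
From mathcomp Require Import all_classical all_reals all_analysis.

Set Implicit Arguments.
Unset Strict Implicit.
Unset Printing Implicit Defensive.

Import Order.TTheory GRing.Theory Num.Theory.
Import numFieldNormedType.Exports.

Local Open Scope classical_set_scope.
Local Open Scope sesquilinear_scope.
Local Open Scope complex_scope.
Local Open Scope ring_scope.

Definition psdmx (R : realType) (p : nat) (A : 'M[R[i]]_p) : Prop :=
  A \is hermsymmx /\ forall x : 'cV[R[i]]_p, 0 <= (x^t* *m A *m x) 0 0.

Definition rel_rank (R : realType) (p : nat) (A : 'M[R[i]]_p) : R :=
  (\rank A)%:R / p%:R.

(* The set is finite, and nonempty when [A] is a nonzero positive semidefinite
   matrix; the infimum is then its smallest element. *)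
Definition lambda_min_pos (R : realType) (p : nat) (A : 'M[R[i]]_p) : R :=
  inf [set a : R | 0 < a /\ eigenvalue A a%:C].

(* A function [F] of [x] that involves [(A + x I)^-1], extended by (entrywise)
   continuity to the points where [A + x I] is singular.  [invmx] is the
   identity on singular matrices, hence the case distinction.  The topology of
   the complex field is carried by its regular module [R[i]^o]. *)
Definition cont_ext (R : realType) (p : nat) (A : 'M[R[i]]_p)
    (F : R -> 'M[R[i]]_p) (x : R) : 'M[R[i]]_p :=
  if A + (x%:C)%:M \in unitmx then F x
  else \matrix_(j, k) (lim ((F y j k : (R[i])^o) @[y --> x^']) : R[i]).

Definition shrink (R : realType) (p : nat) (A : 'M[R[i]]_p) (x : R)
    : 'M[R[i]]_p :=
  cont_ext A (fun y => A *m invmx (A + (y%:C)%:M)) x.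

Definition shrink2 (R : realType) (p : nat) (A : 'M[R[i]]_p) (x : R)
    : 'M[R[i]]_p :=
  cont_ext A (fun y => A ^+ 2 *m (invmx (A + (y%:C)%:M)) ^+ 2) x.

Definition ntr (R : realType) (p : nat) (M : 'M[R[i]]_p) : R[i] :=
  p%:R^-1 * \tr M.

Definition lambda_fun (R : realType) (p : nat) (A : 'M[R[i]]_p)
    (alpha m : R) : R[i] :=
  m%:C * (1 - (alpha^-1)%:C * ntr (shrink A m)).

Definition is_mu0 (R : realType) (p : nat) (A : 'M[R[i]]_p)
    (alpha m0 : R) : Prop :=
  - lambda_min_pos A < m0 /\ alpha%:C = ntr (shrink2 A m0).

Definition mu0 (R : realType) (p : nat) (A : 'M[R[i]]_p) (alpha : R) : R :=
  get [set m0 | is_mu0 A alpha m0].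

Definition is_lambda0 (R : realType) (p : nat) (A : 'M[R[i]]_p)
    (alpha l0 : R) : Prop :=
  l0%:C = lambda_fun A alpha (mu0 A alpha).

Definition lambda0 (R : realType) (p : nat) (A : 'M[R[i]]_p) (alpha : R) : R :=
  get [set l0 | is_lambda0 A alpha l0].

Definition is_mu (R : realType) (p : nat) (A : 'M[R[i]]_p)
    (alpha lam m : R) : Prop :=
  mu0 A alpha < m /\ lam%:C = lambda_fun A alpha m.

Definition mu (R : realType) (p : nat) (A : 'M[R[i]]_p) (alpha lam : R) : R :=
  get [set m | is_mu A alpha lam m].

(* Main.v *)
(* If a_i are the eigenvalues of A, the normalized traces are
   g(x) = p^-1 sum_i a_i / (a_i + x) and h(x) = p^-1 sum_i (a_i / (a_i + x))^2.
   On x > - lambda_min_pos A, h decreases strictly from +oo to 0, which gives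
   mu0, and f_alpha(x) = x (1 - g(x) / alpha) has derivative 1 - h(x) / alpha,
   so that mu0 minimizes f_alpha and f_alpha is a strictly increasing bijection
   from ]mu0, +oo[ to ]lambda0, +oo[, with inverse mu.  Since
   f_beta(x) - f_alpha(x) = x g(x) (1 / alpha - 1 / beta) has the sign of x when
   alpha < beta, the monotonicity of mu in alpha is decided by the sign of mu,
   itself read off f_alpha(0) = 0 and h(0) = rank(A) / p. *)

Require Import Defs.
From mathcomp Require Import all_boot all_order all_algebra.
From mathcomp Require Import complex.
From mathcomp Require Import all_classical all_reals all_analysis.
From mathcomp Require Import ring lra.

Import Order.TTheory GRing.Theory Num.Theory.
Import numFieldNormedType.Exports.

Local Open Scope classical_set_scope.
Local Open Scope complex_scope.
Local Open Scope ring_scope.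

(** * Matrices diagonal in a common basis *)

(** Induction on the size: splitting off the first entry makes the matrix block diagonal, and the
    ranks of the blocks add up. *)
Lemma mxrank_diag (F : fieldType) n (d : 'rV[F]_n) :
  \rank (diag_mx d) = (\sum_i (d 0 i != 0)%R)%N.
Proof.
elim: n d => [|n IHn] d; first by rewrite big_ord0 flatmx0 mxrank0.
have rank_row (l : 'rV[F]_1) (r : 'rV[F]_n) :
    \rank (diag_mx (row_mx l r)) = ((l 0 0 != 0)%R + \rank (diag_mx r))%N.
  rewrite diag_mx_row rank_diag_block_mx rank_rV; congr (_ + _)%N.
  congr nat_of_bool; congr negb; apply/eqP/eqP => [/matrixP/(_ 0 0)|l0].
    by rewrite !mxE eqxx mulr1n.
  by apply/matrixP => i j; rewrite !ord1 !mxE eqxx mulr1n.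
have := rank_row (lsubmx (d : 'rV_(1 + n))) (rsubmx (d : 'rV_(1 + n))).
rewrite hsubmxK IHn big_ord_recl mxE => ->; congr (_ + _)%N.
  by congr (nat_of_bool (d _ _ != 0)); exact/val_inj.
by apply: eq_bigr => i _; rewrite mxE; congr (nat_of_bool (d _ _ != 0)); exact/val_inj.
Qed.

Section Diagonalized.
Context {F : fieldType} {p : nat} (P : 'M[F]_p).

(** For a fixed invertible [P], products, scalar shifts, inverses and traces of these matrices are
    computed pointwise on the index functions. *)
Definition conj_diag (a : 'I_p -> F) : 'M[F]_p :=
  invmx P *m diag_mx (\row_i a i) *m P.

Context (P_unit : P \in unitmx).

Lemma conj_diagM (a b : 'I_p -> F) :
  conj_diag a *m conj_diag b = conj_diag (fun i => a i * b i).
Proof.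
rewrite /conj_diag !mulmxA mulmxK// -[_ *m diag_mx _ *m diag_mx _]mulmxA.
rewrite mulmx_diag; congr (_ *m diag_mx _ *m _).
by apply/rowP => i; rewrite !mxE.
Qed.

Lemma conj_diag_scalar (x : F) : conj_diag (fun=> x) = x%:M.
Proof.
rewrite /conj_diag (_ : \row__ _ = const_mx x).
  by rewrite diag_const_mx mul_mx_scalar -scalemxAl mulVmx// scalemx1.
by apply/rowP => i; rewrite !mxE.
Qed.

Lemma conj_diagD (a : 'I_p -> F) (x : F) :
  conj_diag a + x%:M = conj_diag (fun i => a i + x).
Proof.
rewrite -conj_diag_scalar /conj_diag -mulmxDl -mulmxDr -raddfD.
by congr (_ *m diag_mx _ *m _); apply/rowP => i; rewrite !mxE.
Qed.

Lemma conj_diag_tr (a : 'I_p -> F) : \tr (conj_diag a) = \sum_i a i.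
Proof.
rewrite /conj_diag mxtrace_mulC mulmxA mulmxV// mul1mx mxtrace_diag.
by apply: eq_bigr => i _; rewrite !mxE.
Qed.

Lemma conj_diag_unit (a : 'I_p -> F) :
  (conj_diag a \in unitmx) = [forall i, a i != 0].
Proof.
rewrite /conj_diag !unitmx_mul unitmx_inv P_unit andbT /=.
rewrite unitmxE det_diag unitfE; apply/prodf_neq0/forallP => a0 i.
  by have := a0 i isT; rewrite mxE.
by move=> _; rewrite mxE.
Qed.

Lemma conj_diag_inv (a : 'I_p -> F) : (forall i, a i != 0) ->
  invmx (conj_diag a) = conj_diag (fun i => (a i)^-1).
Proof.
move=> a0; have cu : conj_diag a \in unitmx.
  by rewrite conj_diag_unit; apply/forallP.
apply: (can_inj (mulKmx cu)).
rewrite mulmxV// conj_diagM -conj_diag_scalar; congr (conj_diag _).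
by apply/funext => i; rewrite mulfV.
Qed.

Lemma conj_diag_resolvent (a : 'I_p -> F) (x : F) :
  conj_diag a + x%:M \in unitmx ->
  conj_diag a *m invmx (conj_diag a + x%:M) =
  conj_diag (fun i => a i / (a i + x)).
Proof.
rewrite conj_diagD conj_diag_unit => /forallP ax.
by rewrite conj_diag_inv// conj_diagM.
Qed.

Lemma conj_diag_resolvent2 (a : 'I_p -> F) (x : F) :
  conj_diag a + x%:M \in unitmx ->
  conj_diag a ^+ 2 *m invmx (conj_diag a + x%:M) ^+ 2 =
  conj_diag (fun i => (a i / (a i + x)) ^+ 2).
Proof.
rewrite conj_diagD conj_diag_unit => /forallP ax.
rewrite conj_diag_inv// !expr2 -!mulmxE !conj_diagM.
by congr conj_diag; apply/funext => i; rewrite expr2 mulrACA.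
Qed.

Lemma conj_diag_eigenvalue (a : 'I_p -> F) (x : F) :
  eigenvalue (conj_diag a) x <-> exists i, a i = x.
Proof.
rewrite /eigenvalue /eigenspace kermx_eq0 row_free_unit.
rewrite -raddfN conj_diagD conj_diag_unit.
split.
  by case/forallPn => i; rewrite negbK subr_eq0 => /eqP <-; exists i.
by case=> i <-; apply/forallPn; exists i; rewrite negbK subrr.
Qed.

Lemma conj_diag_rank (a : 'I_p -> F) :
  \rank (conj_diag a) = (\sum_i (a i != 0)%R)%N.
Proof.
rewrite /conj_diag mxrankMfree ?row_free_unit// eqmxMfull; last first.
  by rewrite row_full_unit unitmx_inv.
by rewrite mxrank_diag; apply: eq_bigr => i _; rewrite mxE.
Qed.

(** Each entry is a linear combination of the values of [a] with coefficients that depend on [P]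
    alone, so entrywise limits reduce to scalar ones. *)
Lemma conj_diagE (a : 'I_p -> F) j k :
  conj_diag a j k = \sum_i invmx P j i * P i k * a i.
Proof.
rewrite /conj_diag -mulmxA mul_diag_mx mxE; apply: eq_bigr => i _.
by rewrite !mxE; ring.
Qed.

End Diagonalized.

(** * Scalar theory of the trace functions *)

(** The guard [0 < a] lets zero eigenvalues through at every [x], including [x = 0]: the ratio is
    then constantly 0. *)
Lemma cvg_ratio (R : realType) (a x : R) : 0 <= a -> (0 < a -> 0 < a + x) ->
  a / (a + y) @[y --> x] --> a / (a + x).
Proof.
rewrite le_eqVlt => /predU1P[<- _|a0 /(_ a0) ax].
  by rewrite mul0r; under eq_fun do rewrite mul0r; exact: cvg_cst.
apply: cvgMl_tmp; apply: cvgV; first by rewrite gt_eqF.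
exact: cvgD (cvg_cst _) cvg_id.
Qed.

Lemma ltr_sum_at (R : numDomainType) (I : finType) (F G : I -> R) (i0 : I) :
  (forall i, F i <= G i) -> F i0 < G i0 -> \sum_i F i < \sum_i G i.
Proof.
move=> FG FG0; rewrite (bigD1 i0)//= [ltRHS](bigD1 i0)//=.
by apply: ltr_leD => //; apply: ler_sum.
Qed.

Lemma IVT_eq (R : realType) (f : R -> R) (a b v : R) : a <= b ->
  (forall x, a <= x <= b -> f y @[y --> x] --> f x) ->
  f a <= v <= f b \/ f b <= v <= f a -> exists2 c, a <= c <= b & f c = v.
Proof.
move=> ab fc fv; have [||c] := @IVT R f a b v ab.
- apply: continuous_in_subspaceT => x; rewrite inE /= in_itv /=.
  exact: fc.
- by rewrite ge_min le_max; case: fv => /andP[-> ->]; rewrite ?orbT.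
- by rewrite in_itv => ? ?; exists c.
Qed.

Section MeanRatio.
Context {R : realType} {p : nat} (a : 'I_p -> R) (i0 : 'I_p).
Context (a_ge0 : forall i, 0 <= a i).
Context (ai0_gt0 : 0 < a i0).
Context (ai0_min : forall i, 0 < a i -> a i0 <= a i).

(* A zero eigenvalue contributes [0 / (0 + x) = 0], also at [x = 0] because of
   the convention [0 / 0 = 0]; this agrees with the continuous extension. *)
Definition mean_ratio (x : R) : R := p%:R^-1 * \sum_i a i / (a i + x).

Definition mean_ratio2 (x : R) : R := p%:R^-1 * \sum_i (a i / (a i + x)) ^+ 2.

Definition real_lambda (alpha x : R) : R := x * (1 - alpha^-1 * mean_ratio x).

Let p_gt0 : 0 < p%:R :> R.
Proof. by rewrite ltr0n (leq_ltn_trans _ (ltn_ord i0)). Qed.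

Let a_case i : a i = 0 \/ 0 < a i.
Proof. by have := a_ge0 i; rewrite le_eqVlt => /predU1P[<-|]; [left|right]. Qed.

(** The pole nearest to the origin is [- a i0], so on its right every denominator with a positive
    eigenvalue is positive. *)
Let pole_gt0 i x : - a i0 < x -> 0 < a i -> 0 < a i + x.
Proof. by move=> x_gt /ai0_min; lra. Qed.

Lemma mean_ratio_gt0 x : - a i0 < x -> 0 < mean_ratio x.
Proof.
move=> x_gt; rewrite /mean_ratio mulr_gt0 ?invr_gt0//.
rewrite (bigD1 i0)//= ltr_pwDl ?divr_gt0 ?pole_gt0// sumr_ge0// => i _.
have [->|ai] := a_case i; first by rewrite mul0r.
by rewrite divr_ge0 // ltW// pole_gt0.
Qed.

Lemma mean_ratio2_gt0 x : - a i0 < x -> 0 < mean_ratio2 x.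
Proof.
move=> x_gt; rewrite /mean_ratio2 mulr_gt0 ?invr_gt0// (bigD1 i0)//=.
rewrite ltr_pwDl ?sumr_ge0 ?exprn_gt0 ?divr_gt0 ?pole_gt0// => i _.
exact: sqr_ge0.
Qed.

Lemma mean_ratio2_decr x y : - a i0 < x -> x < y ->
  mean_ratio2 y < mean_ratio2 x.
Proof.
move=> x_gt xy; rewrite /mean_ratio2 ltr_pM2l ?invr_gt0//.
have term i : 0 < a i -> (a i / (a i + y)) ^+ 2 < (a i / (a i + x)) ^+ 2.
  move=> ai; have ax := pole_gt0 _ _ x_gt ai.
  have ay : 0 < a i + y by lra.
  rewrite ltr_pXn2r// ?nnegrE ?divr_ge0 ?(ltW ax) ?(ltW ay)//.
  by rewrite ltr_pM2l// ltf_pV2 ?posrE//; lra.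
apply: (ltr_sum_at _ _ _ _ i0) => [i|]; last exact: term.
by have [->|/term/ltW//] := a_case i; rewrite !mul0r.
Qed.

Lemma cvg_mean_ratio x : - a i0 < x ->
  mean_ratio y @[y --> x] --> mean_ratio x.
Proof.
move=> x_gt; apply: cvgMl_tmp.
apply: cvg_big => [|i _]; first exact: add_continuous.
by apply: cvg_ratio => //; exact: pole_gt0.
Qed.

Lemma cvg_mean_ratio2 x : - a i0 < x ->
  mean_ratio2 y @[y --> x] --> mean_ratio2 x.
Proof.
move=> x_gt; apply: cvgMl_tmp.
apply: cvg_big => [|i _]; first exact: add_continuous.
by apply: cvgM; apply: cvg_ratio => //; exact: pole_gt0.
Qed.

Lemma cvg_real_lambda alpha x : - a i0 < x ->
  real_lambda alpha y @[y --> x] --> real_lambda alpha x.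
Proof.
move=> x_gt; apply: cvgM; first exact: cvg_id.
apply: cvgB; first exact: cvg_cst.
by apply: cvgMl_tmp; exact: cvg_mean_ratio.
Qed.

(** Termwise [x / (a i + x) <= 1]. This decay of order [1 / x] controls the right endpoint in both
    intermediate value arguments below. *)
Lemma mul_mean_ratio_le x : 0 <= x -> x * mean_ratio x <= p%:R^-1 * \sum_i a i.
Proof.
move=> x0; rewrite mulrCA ler_pM2l ?invr_gt0// mulr_sumr ler_sum// => i _.
have [->|ai] := a_case i; first by rewrite mul0r mulr0.
by rewrite mulrCA ler_piMr// ler_pdivrMr; lra.
Qed.

Lemma mean_ratio2_le x : 0 <= x -> mean_ratio2 x <= mean_ratio x.
Proof.
move=> x0; rewrite ler_pM2l ?invr_gt0// ler_sum// => i _.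
have [->|ai] := a_case i; first by rewrite !mul0r expr2 mulr0.
have ax : 0 < a i + x by lra.
rewrite expr2 ler_piMr ?divr_ge0 ?(ltW ax)//.
by rewrite ler_pdivrMr//; lra.
Qed.

Lemma mean_ratio2_surj alpha : 0 < alpha ->
  exists2 x, - a i0 < x & mean_ratio2 x = alpha.
Proof.
move=> alpha0; set C := p%:R^-1 * \sum_i a i.
have C_ge0 : 0 <= C by rewrite mulr_ge0 ?invr_ge0 ?(ltW p_gt0)// sumr_ge0.
(* The factor [t] is chosen so that [a i0 / (a i0 + x1) = 1 + p%:R * alpha]; the square of this
   single term already exceeds [p%:R * alpha]. *)
pose t := (1 + p%:R * alpha)^-1.
have pal : 0 < p%:R * alpha by rewrite mulr_gt0.
have t0 : 0 < t by rewrite invr_gt0; lra.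
have t1 : t <= 1 by rewrite invf_le1; lra.
have tp : t * (1 + p%:R * alpha) = 1 by rewrite mulVf//; lra.
pose x1 := - a i0 + a i0 * t.
have x1_gt : - a i0 < x1 by rewrite ltrDl mulr_gt0.
have x1_le0 : x1 <= 0 by rewrite /x1; have := ler_pM2l ai0_gt0 t 1; rewrite t1; lra.
(* At [x2], [mean_ratio2] is at most [mean_ratio], hence at most [C / x2], which is below [alpha];
   the added 1 keeps [x2] positive. *)
pose x2 := (C + 1) / alpha.
have x2_gt0 : 0 < x2 by rewrite divr_gt0//; lra.
have [x||x] := @IVT_eq R mean_ratio2 x1 x2 alpha (le_trans x1_le0 (ltW x2_gt0)).
- by move=> /andP[x1x _]; apply: cvg_mean_ratio2; exact: lt_le_trans x1x.
- right; apply/andP; split.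
    apply: le_trans (mean_ratio2_le _ (ltW x2_gt0)) _.
    rewrite -(ler_pM2l x2_gt0); apply: le_trans (mul_mean_ratio_le _ (ltW x2_gt0)) _.
    by rewrite /x2 divfK ?gt_eqF// -/C; lra.
  rewrite /mean_ratio2 -(ler_pM2l p_gt0) mulrA mulfV ?gt_eqF// mul1r.
  apply: (@le_trans _ _ ((a i0 / (a i0 + x1)) ^+ 2)).
    rewrite (_ : a i0 / (a i0 + x1) = 1 + p%:R * alpha); last first.
      by rewrite /x1 addrA subrr add0r invfM mulrA mulfV ?gt_eqF// mul1r invrK.
    by rewrite expr2; nra.
  by rewrite (bigD1 i0)//= lerDl sumr_ge0// => i _; rewrite sqr_ge0.
- by move=> /andP[x1x _] <-; exists x => //; exact: lt_le_trans x1x.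
Qed.

(* The derivative of [x * mean_ratio x] is [mean_ratio2 x], which decreases. *)
Lemma mul_mean_ratio_lt x y : - a i0 < x -> x < y ->
  y * mean_ratio y - x * mean_ratio x < (y - x) * mean_ratio2 x.
Proof.
move=> x_gt xy.
rewrite /mean_ratio /mean_ratio2 !(mulrCA _ p%:R^-1) -mulrBr ltr_pM2l ?invr_gt0//.
rewrite !mulr_sumr -sumrB.
have term i : 0 < a i ->
    y * (a i / (a i + y)) - x * (a i / (a i + x)) < (y - x) * (a i / (a i + x)) ^+ 2.
  move=> ai; have ax := pole_gt0 _ _ x_gt ai.
  have ay : 0 < a i + y by lra.
  rewrite -subr_gt0.
  (* The gap between the concave function [a i * x / (a i + x)] and its tangent at [x] is an
     explicit positive quotient. *)
  have -> : (y - x) * (a i / (a i + x)) ^+ 2 -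
      (y * (a i / (a i + y)) - x * (a i / (a i + x))) =
      (a i * (y - x) / (a i + x)) ^+ 2 / (a i + y).
    by field; rewrite !gt_eqF.
  by rewrite divr_gt0// exprn_gt0// divr_gt0// mulr_gt0// subr_gt0.
apply: (ltr_sum_at _ _ _ _ i0) => [i|]; last exact: term.
by have [->|/term/ltW//] := a_case i; rewrite !mul0r expr2 !mulr0 subrr.
Qed.

(** The tangent inequality [mul_mean_ratio_lt] replaces the derivative and also covers the endpoint
    where [mean_ratio2 x = alpha]. *)
Lemma real_lambda_incr alpha x y : 0 < alpha -> - a i0 < x ->
  mean_ratio2 x <= alpha -> x < y -> real_lambda alpha x < real_lambda alpha y.
Proof.
move=> alpha0 x_gt hx xy; rewrite -subr_gt0.
have -> : real_lambda alpha y - real_lambda alpha x =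
    alpha^-1 * ((y - x) * alpha - (y * mean_ratio y - x * mean_ratio x)).
  by rewrite /real_lambda; field; rewrite gt_eqF.
rewrite mulr_gt0 ?invr_gt0// subr_gt0.
apply: lt_le_trans (mul_mean_ratio_lt _ _ x_gt xy) _.
by rewrite ler_pM2l// subr_gt0.
Qed.

Lemma real_lambda_surj alpha x0 l : 0 < alpha -> - a i0 < x0 ->
  mean_ratio2 x0 <= alpha -> real_lambda alpha x0 < l ->
  exists2 x, x0 < x & real_lambda alpha x = l.
Proof.
move=> alpha0 x0_gt hx0 lx0; set C := p%:R^-1 * \sum_i a i.
(* Since [b * mean_ratio b <= C], the value at [b] is at least [b - C / alpha], that is
   [|x0| + |l|], hence at least [l]. *)
pose b := `|x0| + `|l| + C / alpha.
have C_ge0 : 0 <= C / alpha.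
  by rewrite divr_ge0 ?(ltW alpha0)// mulr_ge0 ?invr_ge0 ?(ltW p_gt0)// sumr_ge0.
have b_ge0 : 0 <= b by rewrite !addr_ge0.
have x0b : x0 <= b by have := ler_norm x0; have := normr_ge0 l; rewrite /b; lra.
have [x||x] := @IVT_eq R (real_lambda alpha) x0 b l x0b.
- by move=> /andP[x0x _]; apply: cvg_real_lambda; exact: lt_le_trans x0x.
- left; rewrite (ltW lx0) /= /real_lambda mulrBr mulr1 mulrCA.
  have : alpha^-1 * (b * mean_ratio b) <= C / alpha.
    by rewrite mulrC ler_pM2r ?invr_gt0// mul_mean_ratio_le.
  by have := ler_norm l; have := normr_ge0 x0; rewrite /b; lra.
- rewrite le_eqVlt => /andP[/predU1P[<-|x0x _ <-]]; last by exists x.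
  by move=> _ lE; rewrite lE ltxx in lx0.
Qed.

Lemma real_lambda_alpha alpha1 alpha2 x :
  real_lambda alpha2 x - real_lambda alpha1 x =
  x * mean_ratio x * (alpha1^-1 - alpha2^-1).
Proof. by rewrite /real_lambda; ring. Qed.

Lemma real_lambda0 alpha : real_lambda alpha 0 = 0.
Proof. by rewrite /real_lambda mul0r. Qed.

(** Nonzero eigenvalues contribute 1 and zero ones contribute 0 by [0 / 0 = 0]. The value is the
    relative rank, the threshold in [alpha] at which [m0] changes sign. *)
Lemma mean_ratio2_0 : mean_ratio2 0 = p%:R^-1 * (\sum_i (a i != 0)%R)%N%:R.
Proof.
rewrite /mean_ratio2 natr_sum; congr (_ * _); apply: eq_bigr => i _.
rewrite addr0; have [->|ai] := eqVneq (a i) 0; first by rewrite mul0r expr0n.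
by rewrite mulfV// expr1n.
Qed.

Lemma mean_ratio2_lt x y : - a i0 < x -> - a i0 < y ->
  (mean_ratio2 y < mean_ratio2 x) = (x < y).
Proof.
move=> x_gt y_gt; case: (ltgtP x y) => [xy|yx|->]; last exact: ltxx.
- exact: mean_ratio2_decr.
- by apply/negbTE; rewrite -leNgt ltW// mean_ratio2_decr.
Qed.

(* [m0], [l0] and [m] stand for [mu0], [lambda0] and [mu]. *)
Section Branch.
Context (m0 l0 : R -> R) (m : R -> R -> R).
Context (m0P : forall alpha, 0 < alpha ->
  - a i0 < m0 alpha /\ mean_ratio2 (m0 alpha) = alpha).
Context (l0P : forall alpha, 0 < alpha ->
  l0 alpha = real_lambda alpha (m0 alpha)).
Context (mP : forall alpha lam, 0 < alpha -> l0 alpha < lam ->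
  m0 alpha < m alpha lam /\ real_lambda alpha (m alpha lam) = lam).

(** * Locating [m0] and [m] by comparison with test points *)

Lemma branch0_lt alpha x : 0 < alpha -> - a i0 < x ->
  (m0 alpha < x) = (mean_ratio2 x < alpha).
Proof.
by move=> /m0P[m0_gt m0E] x_gt; rewrite -(mean_ratio2_lt _ _ m0_gt x_gt) m0E.
Qed.

Lemma lt_branch0 alpha x : 0 < alpha -> - a i0 < x ->
  (x < m0 alpha) = (alpha < mean_ratio2 x).
Proof.
by move=> /m0P[m0_gt m0E] x_gt; rewrite -(mean_ratio2_lt _ _ x_gt m0_gt) m0E.
Qed.

Lemma branch0_decr alpha1 alpha2 : 0 < alpha1 -> alpha1 <= alpha2 ->
  m0 alpha2 <= m0 alpha1.
Proof.
move=> alpha1_gt0 a12; have [m1_gt m1E] := m0P _ alpha1_gt0.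
by rewrite leNgt lt_branch0// ?m1E ?(lt_le_trans alpha1_gt0)// -leNgt.
Qed.

(** From [m0 alpha] on, [mean_ratio2] is at most [alpha], so [real_lambda_incr] applies, endpoint
    included. *)
Lemma real_lambda_lt alpha x y : 0 < alpha -> m0 alpha <= x -> m0 alpha <= y ->
  (real_lambda alpha x < real_lambda alpha y) = (x < y).
Proof.
move=> alpha0; have [m0_gt m0E] := m0P _ alpha0.
have incr u v : m0 alpha <= u -> u < v -> real_lambda alpha u < real_lambda alpha v.
  move=> mu uv; have u_gt := lt_le_trans m0_gt mu.
  by apply: real_lambda_incr => //; rewrite leNgt -lt_branch0// -leNgt.
move=> mx my; case: (ltgtP x y) => [xy|yx|->]; last exact: ltxx.
- exact: incr.
- by apply/negbTE; rewrite -leNgt ltW// incr.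
Qed.

(** The main device for what follows: a question about the implicit [m] becomes one about the
    explicit [real_lambda], as long as the test point is not below [m0 alpha]. *)
Lemma branch_lt alpha lam x : 0 < alpha -> l0 alpha < lam -> m0 alpha <= x ->
  (m alpha lam < x) = (lam < real_lambda alpha x).
Proof.
move=> alpha0 lam_gt mx; have [m_gt mE] := mP _ _ alpha0 lam_gt.
by rewrite -{2}mE real_lambda_lt// ltW.
Qed.

Lemma lt_branch alpha lam x : 0 < alpha -> l0 alpha < lam -> m0 alpha <= x ->
  (x < m alpha lam) = (real_lambda alpha x < lam).
Proof.
move=> alpha0 lam_gt mx; have [m_gt mE] := mP _ _ alpha0 lam_gt.
by rewrite -{2}mE real_lambda_lt// ltW.
Qed.

Lemma branch_incr alpha lam1 lam2 : 0 < alpha ->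
  l0 alpha < lam1 -> lam1 <= lam2 -> m alpha lam1 <= m alpha lam2.
Proof.
move=> alpha0 lam1_gt l12; have [m1_gt m1E] := mP _ _ alpha0 lam1_gt.
rewrite leNgt branch_lt// ?(lt_le_trans lam1_gt)// ?(ltW m1_gt)//.
by rewrite m1E -leNgt.
Qed.

Lemma branch_cvg_right alpha : 0 < alpha ->
  m alpha lam @[lam --> (l0 alpha)^'+] --> m0 alpha.
Proof.
move=> alpha0; apply/cvgrPdist_lt => e e0; near=> lam.
have lam_gt : l0 alpha < lam by near: lam; exact: nbhs_right_gt.
have [m_gt _] := mP _ _ alpha0 lam_gt.
(* As [m] lies above [m0], closeness within [e] means [m < m0 alpha + e], which holds as soon as
   [lam] is below the value of [real_lambda] at [m0 alpha + e]; that value exceeds [l0 alpha]. *)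
rewrite ltr0_norm ?subr_lt0// opprB ltrBlDl branch_lt// ?lerDl ?(ltW e0)//.
near: lam; apply: nbhs_right_lt.
by rewrite l0P// real_lambda_lt ?ltrDl ?lerDl// ltW.
Unshelve. all: by end_near. Qed.

Lemma branch_cvg_pinfty alpha : 0 < alpha ->
  m alpha lam @[lam --> +oo] --> +oo.
Proof.
move=> alpha0; apply/cvgryPge => B; near=> lam.
(* Raising [B] to at least [m0 alpha] makes it an admissible test point. *)
apply: (@le_trans _ _ (Num.max B (m0 alpha))); first by rewrite le_max lexx.
rewrite leNgt branch_lt ?le_max ?lexx ?orbT// -?leNgt.
  by near: lam; exact/nbhs_pinfty_ge/num_real.
by near: lam; exact/nbhs_pinfty_gt/num_real.
Unshelve. all: by end_near. Qed.

(** * Dependence of [m] on [alpha] *)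

Lemma branch_decr_alpha alpha1 alpha2 lam : 0 < alpha1 -> alpha1 <= alpha2 ->
  l0 alpha1 < lam -> l0 alpha2 < lam -> 0 <= m alpha1 lam ->
  m alpha2 lam <= m alpha1 lam.
Proof.
move=> alpha1_gt0 a12 lam1 lam2 m_ge0.
have alpha2_gt0 := lt_le_trans alpha1_gt0 a12.
have [m1_gt m1E] := mP _ _ alpha1_gt0 lam1.
(* The point [m alpha1 lam] is above [m0 alpha1], hence above [m0 alpha2], so it is a test point for
   [alpha2]. There [real_lambda alpha2] differs from [lam] by a nonnegative multiple of the point
   itself. *)
rewrite leNgt lt_branch//; last first.
  by rewrite (le_trans (branch0_decr _ _ alpha1_gt0 a12))// ltW.
rewrite -leNgt -{1}m1E -subr_ge0 real_lambda_alpha.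
rewrite mulr_ge0 ?subr_ge0 ?lef_pV2 ?posrE// mulr_ge0// ltW// mean_ratio_gt0//.
by apply: lt_trans m1_gt; case: (m0P _ alpha1_gt0).
Qed.

Lemma branch_incr_alpha alpha1 alpha2 lam : 0 < alpha1 -> alpha1 <= alpha2 ->
  l0 alpha1 < lam -> l0 alpha2 < lam -> m alpha1 lam <= 0 ->
  m alpha1 lam <= m alpha2 lam.
Proof.
move=> alpha1_gt0 a12 lam1 lam2 m_le0.
have alpha2_gt0 := lt_le_trans alpha1_gt0 a12.
have [m1_gt m1E] := mP _ _ alpha1_gt0 lam1.
rewrite leNgt branch_lt//; last first.
  by rewrite (le_trans (branch0_decr _ _ alpha1_gt0 a12))// ltW.
rewrite -leNgt -{2}m1E -subr_le0 real_lambda_alpha.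
rewrite mulr_le0_ge0 ?subr_ge0 ?lef_pV2 ?posrE//.
rewrite mulr_le0_ge0// ltW// mean_ratio_gt0//.
by apply: lt_trans m1_gt; case: (m0P _ alpha1_gt0).
Qed.

(** If [m0 alpha] is nonnegative, so is the larger [m]. Otherwise 0 is a test point, where
    [real_lambda] vanishes, and [alpha < mean_ratio2 0] is impossible. *)
Lemma branch_ge0 alpha lam : 0 < alpha -> l0 alpha < lam ->
  0 <= lam \/ alpha < mean_ratio2 0 -> 0 <= m alpha lam.
Proof.
move=> alpha0 lam_gt; have [m_gt _] := mP _ _ alpha0 lam_gt.
have [m0_ge0|m0_lt0 []] := leP 0 (m0 alpha); first by move=> _; lra.
  by move=> lam_ge0; rewrite leNgt branch_lt ?real_lambda0 -?leNgt// ltW.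
by rewrite -lt_branch0 ?oppr_lt0// => /lt_trans/(_ m0_lt0); rewrite ltxx.
Qed.

(** Beyond the threshold [m0 alpha] is negative, so 0 is a test point. *)
Lemma branch_le0 alpha lam : mean_ratio2 0 < alpha -> l0 alpha < lam ->
  lam < 0 -> m alpha lam <= 0.
Proof.
move=> h0 lam_gt lam_lt0.
have alpha0 : 0 < alpha.
  by apply: lt_trans h0; rewrite mean_ratio2_gt0 ?oppr_lt0.
have m0_lt0 : m0 alpha < 0 by rewrite branch0_lt ?oppr_lt0.
by rewrite ltW// branch_lt ?real_lambda0// ltW.
Qed.

(** Already the lower bound [m0] diverges: it passes a given point once [alpha] is below
    [mean_ratio2] there. Taking the maximum with 0 keeps that point to the right of the pole. *)
Lemma branch_cvg_alpha0 lam : (\forall alpha \near (0 : R)^'+, l0 alpha < lam) ->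
  m alpha lam @[alpha --> (0 : R)^'+] --> +oo.
Proof.
move=> lam_gt; apply/cvgryPge => B.
have B_gt : - a i0 < Num.max B 0 by rewrite lt_max oppr_lt0 ai0_gt0 orbT.
near=> alpha.
have alpha0 : 0 < alpha by near: alpha; exact: nbhs_right_gt.
have [|m_gt _] := mP _ lam alpha0; first by near: alpha.
apply: (@le_trans _ _ (Num.max B 0)); first by rewrite le_max lexx.
rewrite ltW// (lt_trans _ m_gt)// lt_branch0//.
near: alpha; apply: nbhs_right_lt.
exact: mean_ratio2_gt0.
Unshelve. all: by end_near. Qed.

Lemma real_lambda_cvg_alpha x :
  real_lambda alpha x @[alpha --> +oo] --> x.
Proof.
have xE : x * (1 - 0 * mean_ratio x) = x by rewrite mul0r subr0 mulr1.
rewrite -[X in _ --> X]xE.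
apply: cvgMl_tmp; apply: cvgB; first exact: cvg_cst.
apply: cvgMr_tmp; apply: (iffRL (gtr0_cvgV0 (f := id) _)); last exact: cvg_id.
exact/nbhs_pinfty_gt/num_real.
Qed.

Lemma branch_cvg_alpha_pinfty lam : (\forall alpha \near +oo, l0 alpha < lam) ->
  m alpha lam @[alpha --> +oo] --> lam.
Proof.
move=> lam_gt.
(* For large [alpha], [m0 alpha] is negative, which makes [l0 alpha >= m0 alpha]; hence
   [lam > l0 alpha >= m0 alpha > - a i0]. *)
have lam_dom : - a i0 < lam.
  have [alpha] : exists alpha, [/\ 0 < alpha, mean_ratio2 0 < alpha & l0 alpha < lam].
    apply: (@filter_ex _ (+oo : set_system R)); near=> alpha; split; near: alpha.
    - exact/nbhs_pinfty_gt/num_real.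
    - exact/nbhs_pinfty_gt/num_real.
    - exact: lam_gt.
  move=> [alpha0 halpha]; apply: lt_trans; rewrite l0P//.
  have [m0_gt _] := m0P _ alpha0.
  apply: (lt_le_trans m0_gt).
  have m0_lt0 : m0 alpha < 0 by rewrite branch0_lt ?oppr_lt0.
  rewrite -subr_ge0 /real_lambda mulrBr mulr1 addrAC subrr add0r.
  rewrite -mulrN mulr_le0// ?(ltW m0_lt0)// oppr_le0 mulr_ge0 ?invr_ge0 ?(ltW alpha0)//.
  by rewrite ltW// mean_ratio_gt0.
apply/cvgrPdist_lt => e e0.
(* Half of the minimum keeps [d] below [e] and [lam - d] to the right of the pole; for large [alpha]
   both [lam - d] and [lam + d] are then test points, with [real_lambda] values tending to
   themselves. *)
pose d := Num.min e (lam + a i0) / 2.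
have min_gt0 : 0 < Num.min e (lam + a i0) by rewrite lt_min e0; lra.
have d_gt0 : 0 < d by rewrite /d; lra.
have de : d < e by rewrite /d; have := ge_min e e (lam + a i0); rewrite lexx /=; lra.
have dl : d < lam + a i0.
  by rewrite /d; have := ge_min (lam + a i0) e (lam + a i0); rewrite lexx orbT /=; lra.
near=> alpha.
have alpha0 : 0 < alpha by near: alpha; exact/nbhs_pinfty_gt/num_real.
have lam_gta : l0 alpha < lam by near: alpha; exact: lam_gt.
have m0_lt : m0 alpha < lam - d.
  by rewrite branch0_lt//; [near: alpha; exact/nbhs_pinfty_gt/num_real|lra].
rewrite distrC ltr_distl; apply/andP; split.
  apply: (@lt_trans _ _ (lam - d)); first by lra.
  rewrite lt_branch//; last exact: ltW.
  near: alpha; apply: (cvgr_lt (lam - d)); last by lra.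
  exact: real_lambda_cvg_alpha.
apply: (@lt_trans _ _ (lam + d)); last by lra.
rewrite branch_lt//; last by lra.
near: alpha; apply: (cvgr_gt (lam + d)); last by lra.
exact: real_lambda_cvg_alpha.
Unshelve. all: by end_near. Qed.

End Branch.

End MeanRatio.

(** * Spectral form of the matrix functions *)

Lemma psd_spectral_diag_ge0 (C : numClosedFieldType) n (A : 'M[C]_n) :
  A \is hermsymmx -> (forall x : 'cV[C]_n, 0 <= (x^t* *m A *m x)%sesqui 0 0) ->
  forall i, 0 <= spectral_diag A 0 i.
Proof.
move=> /hermitian_normalmx /orthomx_spectralP A_eq A_ge0 i.
have PP := unitarymxP (spectral_unitarymx A).
(* The quadratic form is tested on the [i]-th eigenvector, the [i]-th column of the adjoint of the
   unitary eigenbasis matrix. *)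
have := A_ge0 ((spectralmx A)^t*%sesqui *m delta_mx i 0).
rewrite trmx_mul map_mxM trmxCK {2}A_eq !mulmxA mulmxK ?spectral_unit//.
rewrite -[_ *m _ *m _^t*%sesqui]mulmxA PP mulmx1.
rewrite trmx_delta map_delta_mx -rowE row_diag_mx -scalemxAl mul_delta_mx.
by rewrite !mxE !eqxx mulr1.
Qed.

Section RealPart.
Context {R : realType} {p : nat} (A : 'M[R[i]]_p).

(** In the order on complex numbers, nonnegative entails real, so the spectrum is recovered from its
    real parts. *)
Lemma psdmx_conj_diag : psdmx A ->
  exists P (a : 'I_p -> R), [/\ P \in unitmx, forall i, 0 <= a i &
    A = conj_diag P (fun i => (a i)%:C)].
Proof.
move=> [Aherm A_ge0].
have d_ge0 := psd_spectral_diag_ge0 _ _ _ Aherm A_ge0.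
exists (spectralmx A), (fun i => complex.Re (spectral_diag A 0 i)); split.
- exact: spectral_unit.
- by move=> i; have := d_ge0 i; rewrite lecE => /andP[].
suff dE : spectral_diag A = \row_i (complex.Re (spectral_diag A 0 i))%:C.
  by rewrite /conj_diag -dE; exact/orthomx_spectralP/hermitian_normalmx.
by apply/rowP => i; rewrite mxE RRe_real//; exact/ger0_real.
Qed.

Lemma cvg_real_complex (T : Type) (F : set_system T) (FF : Filter F)
    (f : T -> R) (l : R) :
  f x @[x --> F] --> l -> ((f x)%:C : R[i]^o) @[x --> F] --> (l%:C : R[i]^o).
Proof.
move=> /cvgrPdist_lt fl; apply/cvgrPdist_lt => e e0.
(* The tolerance [e] is a complex number; its positivity forces it to be real. *)
have eE : e = (complex.Re e)%:C by rewrite RRe_real// gtr0_real.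
have Re0 : 0 < complex.Re e by move: e0; rewrite ltcE => /andP[].
near=> x; rewrite -rmorphB normc_def /= expr0n addr0 sqrtr_sqr eE ltcR.
by near: x; exact: fl.
Unshelve. all: by end_near. Qed.

(** The case [c = x] is covered because the neighbourhood is punctured; this serves to avoid the
    finitely many singular shifts. *)
Lemma dnbhs_neq (x c : R) : \forall y \near x^', y != c.
Proof.
have [->|xc] := eqVneq x c; first exact: nbhs_dnbhs_neq.
apply: nbhs_dnbhs.
by apply: open_nbhs_nbhs; split => //; exact: open_neq.
Qed.

(** Only finitely many shifts are singular, so near a singular [x] the spectral form of [F] is
    available, and its entries converge because each [phi i] is continuous at [x]. *)
Lemma cont_ext_conj_diag (P : 'M[R[i]]_p) (a : 'I_p -> R)
    (F : R -> 'M[R[i]]_p) (phi : 'I_p -> R -> R) (x : R) :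
  P \in unitmx -> A = conj_diag P (fun i => (a i)%:C) ->
  (forall y, A + (y%:C)%:M \in unitmx ->
     F y = conj_diag P (fun i => (phi i y)%:C)) ->
  (forall i, phi i y @[y --> x] --> phi i x) ->
  cont_ext A F x = conj_diag P (fun i => (phi i x)%:C).
Proof.
move=> Pu AE FE phic; rewrite /cont_ext; case: ifPn => [/FE //|_].
have unear : \forall y \near x^', A + (y%:C)%:M \in unitmx.
  have : \forall y \near x^', forall i, i \in [set: 'I_p]%SET -> y != - a i.
    apply: filter_forall => i; near=> y => _; near: y; exact: dnbhs_neq.
  apply: filterS => y ya.
  rewrite AE conj_diagD// conj_diag_unit//; apply/forallP => i.
  by rewrite -rmorphD fmorph_eq0 addrC addr_eq0; apply: ya; rewrite inE.
apply/matrixP => j k; rewrite mxE conj_diagE.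
apply: (@cvg_lim (R[i]^o)).
  exact: norm_hausdorff.
apply: (@cvg_trans _ ((\sum_i invmx P j i * P i k * (phi i y)%:C : R[i]^o) @[y --> x^'])).
  apply: near_eq_cvg; apply: filterS unear => y /FE ->.
  by rewrite conj_diagE.
apply: cvg_big => [|i _]; first exact: add_continuous.
apply: cvgMl_tmp.
by apply: cvg_real_complex => B /phic; exact: nbhs_dnbhs.
Unshelve. all: by end_near. Qed.

Lemma shrink_conj_diag (P : 'M[R[i]]_p) (a : 'I_p -> R) (x : R) :
  P \in unitmx -> A = conj_diag P (fun i => (a i)%:C) ->
  (forall i, 0 <= a i) -> (forall i, 0 < a i -> 0 < a i + x) ->
  shrink A x = conj_diag P (fun i => (a i / (a i + x))%:C) /\
  shrink2 A x = conj_diag P (fun i => ((a i / (a i + x)) ^+ 2)%:C).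
Proof.
move=> Pu AE a0 ax.
have ratioE i y : (a i)%:C / ((a i)%:C + y%:C) = (a i / (a i + y))%:C.
  by rewrite -rmorphD -fmorphV -rmorphM.
split.
- apply: (cont_ext_conj_diag P a _ (fun i y => a i / (a i + y)) x Pu AE).
    move=> y; rewrite AE => /(conj_diag_resolvent _ Pu) ->.
    by congr conj_diag; apply/funext => i; exact: ratioE.
  by move=> i; apply: cvg_ratio => //; exact: ax.
- apply: (cont_ext_conj_diag P a _ (fun i y => (a i / (a i + y)) ^+ 2) x Pu AE).
    move=> y; rewrite AE => /(conj_diag_resolvent2 _ Pu) ->.
    by congr conj_diag; apply/funext => i; rewrite ratioE rmorphXn.
  by move=> i; apply: cvgM; apply: cvg_ratio => //; exact: ax.
Qed.

Lemma lambda_min_pos_conj_diag (P : 'M[R[i]]_p) (a : 'I_p -> R) (i : 'I_p) :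
  P \in unitmx -> A = conj_diag P (fun i => (a i)%:C) ->
  0 < a i -> (forall j, 0 < a j -> a i <= a j) -> lambda_min_pos A = a i.
Proof.
move=> Pu AE ai0 ai_min; rewrite /lambda_min_pos.
set S := [set _ | _]; have Sai : S (a i).
  by split => //; rewrite AE; apply/conj_diag_eigenvalue => //; exists i.
have Slb : lbound S (a i).
  move=> y [y0]; rewrite AE => /conj_diag_eigenvalue -/(_ Pu)[j /complexI aj].
  by rewrite -aj; apply: ai_min; rewrite aj.
apply/eqP; rewrite eq_le; apply/andP; split.
  by apply: inf_lbound => //; exists (a i).
by apply: lb_le_inf => //; exists (a i).
Qed.

End RealPart.

(** * Characterization of [mu0], [lambda0] and [mu] through the eigenvalues *)

Section Spectrum.
Context {R : realType} {p : nat} (A : 'M[R[i]]_p).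
Context (P : 'M[R[i]]_p) (a : 'I_p -> R) (i0 : 'I_p).
Context (P_unit : P \in unitmx).
Context (AE : A = conj_diag P (fun i => (a i)%:C)).
Context (a_ge0 : forall i, 0 <= a i).
Context (ai0_gt0 : 0 < a i0).
Context (ai0_min : forall i, 0 < a i -> a i0 <= a i).

Lemma ntr_conj_diag (b : 'I_p -> R) :
  ntr (conj_diag P (fun i => (b i)%:C)) = (p%:R^-1 * \sum_i b i)%:C.
Proof.
rewrite /ntr (conj_diag_tr _ P_unit).
by rewrite [RHS]rmorphM fmorphV rmorph_nat rmorph_sum.
Qed.

Lemma ntr_shrink x : - a i0 < x ->
  ntr (shrink A x) = (mean_ratio a x)%:C /\
  ntr (shrink2 A x) = (mean_ratio2 a x)%:C.
Proof.
move=> x_gt; have ax i : 0 < a i -> 0 < a i + x by move=> /ai0_min; lra.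
have [-> ->] := shrink_conj_diag _ _ _ x P_unit AE a_ge0 ax.
by split; exact: ntr_conj_diag.
Qed.

Lemma lambda_funE alpha x : - a i0 < x ->
  lambda_fun A alpha x = (real_lambda a alpha x)%:C.
Proof.
move=> /ntr_shrink[shE _]; rewrite /lambda_fun shE.
by rewrite -rmorphM -(rmorph1 (real_complex R)) -rmorphB -rmorphM.
Qed.

Lemma is_mu0E alpha x :
  is_mu0 A alpha x <-> - a i0 < x /\ mean_ratio2 a x = alpha.
Proof.
rewrite /is_mu0 (lambda_min_pos_conj_diag A _ _ _ P_unit AE ai0_gt0 ai0_min).
split=> -[x_gt]; have [_ hE] := ntr_shrink x x_gt.
  by rewrite hE => /complexI <-.
by move=> <-; rewrite hE.
Qed.

Lemma is_mu0_ex1 alpha : 0 < alpha -> exists! x, is_mu0 A alpha x.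
Proof.
move=> alpha0.
have [x x_gt hx] := mean_ratio2_surj a i0 a_ge0 ai0_gt0 ai0_min _ alpha0.
exists x; split=> [|y /is_mu0E[y_gt hy]]; first exact/is_mu0E.
have lt_h := mean_ratio2_lt a i0 a_ge0 ai0_gt0 ai0_min.
by apply/eqP; rewrite eq_le !leNgt -(lt_h x y)// -(lt_h y x)// hx hy ltxx.
Qed.

(** Existence of a solution is what makes the choice operator [get] return one. *)
Lemma mu0P alpha : 0 < alpha ->
  - a i0 < mu0 A alpha /\ mean_ratio2 a (mu0 A alpha) = alpha.
Proof.
move=> /is_mu0_ex1[x [xP _]]; apply/is_mu0E.
exact: (@getPex _ [set m | is_mu0 A alpha m] (ex_intro _ x xP)).
Qed.

Lemma is_lambda0E alpha l : 0 < alpha ->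
  is_lambda0 A alpha l <-> l = real_lambda a alpha (mu0 A alpha).
Proof.
move=> /mu0P[m_gt _]; rewrite /is_lambda0 lambda_funE//.
by split=> [/complexI//|->].
Qed.

Lemma lambda0E alpha : 0 < alpha ->
  lambda0 A alpha = real_lambda a alpha (mu0 A alpha).
Proof.
move=> alpha0; apply/is_lambda0E => //.
apply: (@getPex _ [set l | is_lambda0 A alpha l]).
by exists (real_lambda a alpha (mu0 A alpha)); apply/is_lambda0E.
Qed.

Lemma is_muE alpha lam x : 0 < alpha ->
  is_mu A alpha lam x <-> mu0 A alpha < x /\ real_lambda a alpha x = lam.
Proof.
move=> /mu0P[m_gt _]; rewrite /is_mu.
split=> -[x_gt]; rewrite lambda_funE ?(lt_trans m_gt)//; first by move/complexI.
by move=> ->.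
Qed.

Lemma is_mu_ex1 alpha lam : 0 < alpha -> lambda0 A alpha < lam ->
  exists! x, is_mu A alpha lam x.
Proof.
move=> alpha0; rewrite lambda0E// => lam_gt; have [m_gt mE] := mu0P _ alpha0.
have [|x x_gt xE] := real_lambda_surj a i0 a_ge0 ai0_min
  alpha (mu0 A alpha) lam alpha0 m_gt _ lam_gt; first by rewrite mE.
exists x; split=> [|y /(is_muE _ _ _ alpha0)[y_gt yE]]; first exact/is_muE.
(* Uniqueness comes from strict monotonicity of [real_lambda] to the right of [mu0 A alpha]. *)
have lt_l := real_lambda_lt a i0 a_ge0 ai0_gt0 ai0_min (mu0 A) mu0P.
apply/eqP; rewrite eq_le !leNgt -(lt_l _ x y alpha0) ?ltW//.
by rewrite -(lt_l _ y x alpha0) ?ltW// xE yE ltxx.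
Qed.

Lemma muP alpha lam : 0 < alpha -> lambda0 A alpha < lam ->
  mu0 A alpha < mu A alpha lam /\ real_lambda a alpha (mu A alpha lam) = lam.
Proof.
move=> alpha0 lam_gt; have [x [xP _]] := is_mu_ex1 _ _ alpha0 lam_gt.
apply/(is_muE _ _ _ alpha0).
exact: (@getPex _ [set m | is_mu A alpha lam m] (ex_intro _ x xP)).
Qed.

Lemma rel_rankE : rel_rank A = mean_ratio2 a 0.
Proof.
rewrite /rel_rank mean_ratio2_0 AE (conj_diag_rank _ P_unit) mulrC.
congr (_ * _%:R); apply: eq_bigr => i _.
by rewrite (inj_eq (@complexI R)).
Qed.

End Spectrum.

Theorem proposition5p3 (R : realType) (p : nat) (A : 'M[R[i]]_p)
    (A_neq0 : A != 0) (A_psd : psdmx A) :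
  (forall alpha : R, 0 < alpha ->
    [/\ exists! m0 : R, is_mu0 A alpha m0,
        exists! l0 : R, is_lambda0 A alpha l0
      & forall lam : R, lambda0 A alpha < lam ->
          exists! m : R, is_mu A alpha lam m])
  /\
  (forall alpha : R, 0 < alpha ->
    [/\ forall lam1 lam2 : R, lambda0 A alpha < lam1 -> lam1 <= lam2 ->
          mu A alpha lam1 <= mu A alpha lam2,
        mu A alpha lam @[lam --> (lambda0 A alpha)^'+] --> mu0 A alpha
      & mu A alpha lam @[lam --> +oo] --> +oo])
  /\
  (forall lam : R, 0 <= lam ->
    forall alpha1 alpha2 : R, 0 < alpha1 -> alpha1 <= alpha2 ->
      lambda0 A alpha1 < lam -> lambda0 A alpha2 < lam ->
      mu A alpha2 lam <= mu A alpha1 lam)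
  /\
  (forall lam : R, lam < 0 ->
    (forall alpha1 alpha2 : R,
      0 < alpha1 -> alpha1 <= alpha2 -> alpha2 < rel_rank A ->
      lambda0 A alpha1 < lam -> lambda0 A alpha2 < lam ->
      mu A alpha2 lam <= mu A alpha1 lam)
    /\
    (forall alpha1 alpha2 : R,
      rel_rank A < alpha1 -> alpha1 <= alpha2 ->
      lambda0 A alpha1 < lam -> lambda0 A alpha2 < lam ->
      mu A alpha1 lam <= mu A alpha2 lam))
  /\
  (forall lam : R,
    ((\forall alpha \near (0 : R)^'+, lambda0 A alpha < lam) ->
      mu A alpha lam @[alpha --> (0 : R)^'+] --> +oo)
    /\
    ((\forall alpha \near +oo, lambda0 A alpha < lam) ->
      mu A alpha lam @[alpha --> +oo] --> lam)).
Proof.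
have [P [a [Pu a_ge0 AE]]] := psdmx_conj_diag A A_psd.
(* Were no eigenvalue positive, all would vanish and [A] would be 0. *)
have [j aj] : exists j, 0 < a j.
  apply/existsP; apply: contraNT A_neq0 => /existsPn a_le0.
  rewrite AE; apply/eqP/matrixP => k l; rewrite conj_diagE mxE big1// => i _.
  suff -> : a i = 0 by rewrite mulr0.
  by apply/eqP; rewrite eq_le a_ge0 leNgt a_le0.
have [i0 ai0_gt0 ai0_min] := @arg_minP _ R _ j (fun i => 0 < a i) a aj.
have m0P := mu0P A P a i0 Pu AE a_ge0 ai0_gt0 ai0_min.
have l0P := lambda0E A P a i0 Pu AE a_ge0 ai0_gt0 ai0_min.
have mP := muP A P a i0 Pu AE a_ge0 ai0_gt0 ai0_min.
have rE := rel_rankE A P a Pu AE.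
split; [|split; [|split; [|split]]].
- move=> alpha alpha0; split.
  + exact: (is_mu0_ex1 A P a i0 Pu AE).
  + exists (real_lambda a alpha (mu0 A alpha)).
    by split=> [|l]; [apply/(is_lambda0E A P a i0) | move/(is_lambda0E A P a i0) => ->].
  + by move=> lam; exact: (is_mu_ex1 A P a i0 Pu AE).
- move=> alpha alpha0; split.
  + move=> lam1 lam2.
    exact: (branch_incr a i0 a_ge0 ai0_gt0 ai0_min _ _ _ m0P mP).
  + exact: (branch_cvg_right a i0 a_ge0 ai0_gt0 ai0_min _ _ _ m0P l0P mP).
  + exact: (branch_cvg_pinfty a i0 a_ge0 ai0_gt0 ai0_min _ _ _ m0P mP).
- move=> lam lam_ge0 alpha1 alpha2 alpha1_gt0 a12 lam1 lam2.
  apply: (branch_decr_alpha a i0 a_ge0 ai0_gt0 ai0_min _ _ _ m0P mP) => //.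
  by apply: (branch_ge0 a i0 a_ge0 ai0_gt0 ai0_min _ _ _ m0P mP) => //; left.
- move=> lam lam_lt0; rewrite rE; split=> alpha1 alpha2.
  + move=> alpha1_gt0 a12 a2r lam1 lam2.
    apply: (branch_decr_alpha a i0 a_ge0 ai0_gt0 ai0_min _ _ _ m0P mP) => //.
    apply: (branch_ge0 a i0 a_ge0 ai0_gt0 ai0_min _ _ _ m0P mP) => //.
    by right; exact: le_lt_trans a2r.
  + move=> ra1 a12 lam1 lam2.
    apply: (branch_incr_alpha a i0 a_ge0 ai0_gt0 ai0_min _ _ _ m0P mP) => //.
      (* Positivity of [alpha1] follows from that of the relative rank. *)
      by apply: lt_trans ra1; rewrite (mean_ratio2_gt0 a i0)// oppr_lt0.
    exact: (branch_le0 a i0 a_ge0 ai0_gt0 ai0_min _ _ _ m0P mP).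
- move=> lam; split.
  + exact: (branch_cvg_alpha0 a i0 a_ge0 ai0_gt0 ai0_min _ _ _ m0P mP).
  + exact: (branch_cvg_alpha_pinfty a i0 a_ge0 ai0_gt0 ai0_min _ _ _ m0P l0P mP).
Qed.
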